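(* Let $f_1,\dots,f_n:\mathbb{R}^d\to\mathbb{R}$ be differentiable and $f(x)=\frac1n\sum_{i=1}^n f_i(x)$. Assume: (1) there is $L>0$ with $\|\nabla f(x)-\nabla f(y)\|\le L\|x-y\|$ for all $x,y\in\mathbb{R}^d$; (2) there is $f^*\in\mathbb{R}$ with $f(x)\ge f^*$ for all $x\in\mathbb{R}^d$; (3) there is $L_+\ge 0$ with $\frac1n\sum_{i=1}^n\|\nabla f_i(x)-\nabla f_i(y)\|^2\le L_+^2\|x-y\|^2$ for all $x,y\in\mathbb{R}^d$. Let $K_1,\dots,K_n\in\{1,\dots,d\}$, $\alpha_i=\frac{\min\{K_i,|\mathcal{J}_i|\}}{|\mathcal{J}_i|}$, $\alpha=\min_i\alpha_i$, $\theta=1-\sqrt{1-\alpha}$, $\beta=\frac{1-\alpha}{1-\sqrt{1-\alpha}}$, and let the stepsize satisfy $$0<\gamma\le \frac{1}{L+L_+\sqrt{\frac{\beta c}{\theta n}}}.$$ Then, for every $T\ge 1$, the iterates of the EF21 algorithm (with arbitrary $x^0\in\mathbb{R}^d$ and $g_i^0\in\mathbb{R}^d_i$, $i=1,\dots,n$) satisfy $$\frac1T\sum_{t=0}^{T-1}\|\nabla f(x^t)\|^2\le \frac{2\,(f(x^0)-f^* )}{\gamma T}+\frac{c}{n}\,\frac{G^0}{\theta T}.$$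
   Context: Norms are Euclidean; $[n]=\{1,\dots,n\}$. Sparsity pattern: $\mathcal{Z}=\{(i,j)\in[n]\times[d] : [\nabla f_i(x)]_j=0\ \forall x\in\mathbb{R}^d\}$ (pairs for which $f_i$ does not depend on $x_j$), $\mathcal{I}_j=\{i\in[n]:(i,j)\notin\mathcal{Z}\}$, $\mathcal{J}_i=\{j\in[d]:(i,j)\notin\mathcal{Z}\}$; it is assumed throughout that $|\mathcal{I}_j|\ge1$ and $|\mathcal{J}_i|\ge1$ for all $i,j$. Set $c=\max_{j\in[d]}|\mathcal{I}_j|$, and $\mathbb{R}^d_i=\{u\in\mathbb{R}^d : u_j=0 \text{ whenever } (i,j)\in\mathcal{Z}\}$. $\mathrm{Top}_K:\mathbb{R}^d\to\mathbb{R}^d$ keeps the $K$ entries of largest magnitude of its argument (ties broken by any fixed rule) and sets the other $d-K$ entries to zero. EF21 algorithm: given $x^0\in\mathbb{R}^d$, $g_i^0\in\mathbb{R}^d_i$, stepsize $\gamma>0$ and $K_1,\dots,K_n\in[d]$, set $g^0=\frac1n\sum_i g_i^0$ and for $t=0,1,2,\dots$: $x^{t+1}=x^t-\gamma g^t$; $g_i^{t+1}=g_i^t+\mathrm{Top}_{K_i}(\nabla f_i(x^{t+1})-g_i^t)$ for $i\in[n]$; $g^{t+1}=\frac1n\sum_{i=1}^n g_i^{t+1}$. $G^t=\frac1n\sum_{i=1}^n\|g_i^t-\nabla f_i(x^t)\|^2$. *)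

(* Defs.v *)
From HB Require Import structures.
From mathcomp Require Import all_boot all_order all_algebra.
From mathcomp Require Import boolp classical_sets functions reals topology.
From mathcomp Require Import normedtype derive.

Set Implicit Arguments.
Unset Strict Implicit.
Unset Printing Implicit Defensive.

Import Order.TTheory GRing.Theory Num.Theory.
Import numFieldNormedType.Exports.

Local Open Scope ring_scope.

(* The library norm `|x| on 'rV[R]_d is the sup norm, hence this definition;
   both norms induce the same topology and the same notion of
   differentiability. *)
Definition enorm (R : realType) (d : nat) (u : 'rV[R]_d) : R :=
  Num.sqrt (\sum_(j < d) u ord0 j ^+ 2).

Definition grad (R : realType) (d : nat) (h : 'rV[R]_d -> R)
    (x : 'rV[R]_d) : 'rV[R]_d :=
  \row_(j < d) 'D_(delta_mx ord0 j) h x.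

Definition favg (R : realType) (n d : nat) (f : 'I_n -> 'rV[R]_d -> R)
    (x : 'rV[R]_d) : R :=
  n%:R^-1 * \sum_(i < n) f i x.

Definition inZ (R : realType) (n d : nat) (f : 'I_n -> 'rV[R]_d -> R)
    (i : 'I_n) (j : 'I_d) : bool :=
  `[< forall x : 'rV[R]_d, grad (f i) x ord0 j = 0 >].

Definition Icol (R : realType) (n d : nat) (f : 'I_n -> 'rV[R]_d -> R)
    (j : 'I_d) : {set 'I_n} :=
  [set i | ~~ inZ f i j]%SET.

Definition Jrow (R : realType) (n d : nat) (f : 'I_n -> 'rV[R]_d -> R)
    (i : 'I_n) : {set 'I_d} :=
  [set j | ~~ inZ f i j]%SET.

Definition cmax (R : realType) (n d : nat) (f : 'I_n -> 'rV[R]_d -> R) : nat :=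
  \max_(j < d) #|Icol f j|.

Definition in_Rdi (R : realType) (n d : nat) (f : 'I_n -> 'rV[R]_d -> R)
    (i : 'I_n) (u : 'rV[R]_d) : Prop :=
  forall j : 'I_d, inZ f i j -> u ord0 j = 0.

(* S is the set of kept coordinates; when there are ties several S qualify,
   and a tie-breaking rule is a choice of one S for each v. *)
Definition is_topK (R : realType) (d K : nat) (v w : 'rV[R]_d) : Prop :=
  exists S : {set 'I_d},
    [/\ #|S| = K,
        forall j k : 'I_d, j \in S -> k \notin S ->
          `|v ord0 k| <= `|v ord0 j| &
        w = \row_(j < d) (if j \in S then v ord0 j else 0)].

Definition is_Top (R : realType) (d : nat)
    (Top : nat -> 'rV[R]_d -> 'rV[R]_d) : Prop :=
  forall (K : nat) (v : 'rV[R]_d), (1 <= K <= d)%N -> is_topK K v (Top K v).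

Definition gmean (R : realType) (n d : nat) (g : 'I_n -> 'rV[R]_d) : 'rV[R]_d :=
  n%:R^-1 *: \sum_(i < n) g i.

Section EF21.
Variables (R : realType) (n d : nat) (f : 'I_n -> 'rV[R]_d -> R).
Variables (Top : nat -> 'rV[R]_d -> 'rV[R]_d) (K : 'I_n -> nat) (gamma : R).
Variables (x0 : 'rV[R]_d) (g0 : 'I_n -> 'rV[R]_d).

(* The state at time t is the pair (x^t, (g_i^t)_i). *)
Fixpoint ef21 (t : nat) : 'rV[R]_d * ('I_n -> 'rV[R]_d) :=
  if t is s.+1 then
    let: (x, g) := ef21 s in
    let x' := x - gamma *: gmean g in
    (x', fun i => g i + Top (K i) (grad (f i) x' - g i))
  else (x0, g0).

Definition ef21_x (t : nat) : 'rV[R]_d := (ef21 t).1.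
Definition ef21_g (t : nat) : 'I_n -> 'rV[R]_d := (ef21 t).2.

Definition Gerr (t : nat) : R :=
  n%:R^-1 * \sum_(i < n) enorm (ef21_g t i - grad (f i) (ef21_x t)) ^+ 2.

End EF21.

Definition alpha_i (R : realType) (n d : nat) (f : 'I_n -> 'rV[R]_d -> R)
    (K : 'I_n -> nat) (i : 'I_n) : R :=
  (minn (K i) #|Jrow f i|)%:R / #|Jrow f i|%:R.

(* Every alpha_i is at most 1, so the default value 1 of the iterated minimum
   does not affect it when n > 0. *)
Definition alpha_min (R : realType) (n d : nat) (f : 'I_n -> 'rV[R]_d -> R)
    (K : 'I_n -> nat) : R :=
  \big[Num.min/1]_(i < n) alpha_i f K i.

Definition theta (R : realType) (alpha : R) : R := 1 - Num.sqrt (1 - alpha).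

Definition beta (R : realType) (alpha : R) : R :=
  (1 - alpha) / (1 - Num.sqrt (1 - alpha)).

(* Main.v *)
(* Two inequalities couple f(x^t) and G^t. The descent lemma bounds f(x^{t+1}) by
   f(x^t) - gamma/2 |grad f(x^t)|^2 - gamma/2 (1 - L gamma) |g^t|^2
   + gamma/2 |g^t - grad f(x^t)|^2, and sparsity bounds the last square by
   (c/n) G^t, because coordinate j only averages |I_j| nonzero errors. On vectors
   supported in J_i, Top_{K_i} contracts the squared error by 1 - alpha_i, so
   Young's inequality gives
   G^{t+1} <= (1 - theta) G^t + beta L_+^2 gamma^2 |g^t|^2.
   Under the stepsize condition the |g^t|^2 terms cancel in the Lyapunov function
   f(x^t) - f^* + gamma c / (2 n theta) G^t, and the bound telescopes. *)

Require Import Defs.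
From HB Require Import structures.
From mathcomp Require Import all_boot all_order all_algebra.
From mathcomp Require Import boolp classical_sets functions reals topology.
From mathcomp Require Import normedtype derive.
From mathcomp Require Import ring lra.

Set Implicit Arguments.
Unset Strict Implicit.
Unset Printing Implicit Defensive.

Import Order.TTheory GRing.Theory Num.Theory.
Import numFieldNormedType.Exports.

Local Open Scope ring_scope.

(** * Cauchy-Schwarz and the Euclidean norm *)

Lemma sum_mul_sqr_le (R : realFieldType) (I : finType) (P : pred I)
    (a b : I -> R) :
  (\sum_(i | P i) a i * b i) ^+ 2
    <= (\sum_(i | P i) a i ^+ 2) * (\sum_(i | P i) b i ^+ 2).
Proof.
set A := \sum_(i | P i) a i ^+ 2; set B := \sum_(i | P i) b i ^+ 2.
set C := \sum_(i | P i) a i * b i.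
(* Lagrange's identity: this nonnegative double sum is twice the gap between the two sides. *)
have : 0 <= \sum_(i | P i) \sum_(j | P j) (a i * b j - a j * b i) ^+ 2.
  by apply: sumr_ge0 => i _; apply: sumr_ge0 => j _; exact: sqr_ge0.
suff -> : \sum_(i | P i) \sum_(j | P j) (a i * b j - a j * b i) ^+ 2
    = A * B + B * A - 2 * (C * C) by move=> ?; lra.
rewrite /A /B /C !big_distrlr mulr_sumr -big_split -sumrB.
apply: eq_bigr => i _; rewrite mulr_sumr -big_split -sumrB.
by apply: eq_bigr => j _ /=; ring.
Qed.

Definition dot (R : realType) (d : nat) (u v : 'rV[R]_d) : R :=
  \sum_(j < d) u ord0 j * v ord0 j.

Lemma enorm_sqr (R : realType) (d : nat) (u : 'rV[R]_d) :
  enorm u ^+ 2 = \sum_(j < d) u ord0 j ^+ 2.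
Proof. by rewrite sqr_sqrtr// sumr_ge0// => j _; exact: sqr_ge0. Qed.

Lemma enorm_ge0 (R : realType) (d : nat) (u : 'rV[R]_d) : 0 <= enorm u.
Proof. exact: sqrtr_ge0. Qed.

Lemma dotZr (R : realType) (d : nat) (a : R) (u v : 'rV[R]_d) :
  dot u (a *: v) = a * dot u v.
Proof. by rewrite /dot mulr_sumr; apply: eq_bigr => j _; rewrite mxE; ring. Qed.

Lemma dotBl (R : realType) (d : nat) (u v w : 'rV[R]_d) :
  dot (u - v) w = dot u w - dot v w.
Proof. by rewrite /dot -sumrB; apply: eq_bigr => j _; rewrite !mxE; ring. Qed.

Lemma enormZ_sqr (R : realType) (d : nat) (a : R) (u : 'rV[R]_d) :
  enorm (a *: u) ^+ 2 = a ^+ 2 * enorm u ^+ 2.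
Proof.
by rewrite !enorm_sqr mulr_sumr; apply: eq_bigr => j _; rewrite mxE exprMn.
Qed.

Lemma enormZ (R : realType) (d : nat) (a : R) (u : 'rV[R]_d) :
  enorm (a *: u) = `|a| * enorm u.
Proof.
apply/eqP; rewrite -(@eqrXn2 _ 2) ?mulr_ge0 ?enorm_ge0//.
by rewrite enormZ_sqr exprMn real_normK ?num_real.
Qed.

Lemma enormN (R : realType) (d : nat) (u : 'rV[R]_d) : enorm (- u) = enorm u.
Proof. by rewrite -scaleN1r enormZ normrN1 mul1r. Qed.

Lemma enormB_sqr (R : realType) (d : nat) (u v : 'rV[R]_d) :
  enorm (u - v) ^+ 2 = enorm u ^+ 2 + enorm v ^+ 2 - 2 * dot u v.
Proof.
rewrite !enorm_sqr /dot mulr_sumr -big_split -sumrB /=.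
by apply: eq_bigr => j _; rewrite !mxE; ring.
Qed.

Lemma dot_le_enorm (R : realType) (d : nat) (u v : 'rV[R]_d) :
  dot u v <= enorm u * enorm v.
Proof.
apply: le_trans (ler_norm _) _.
rewrite -ler_sqr ?nnegrE ?mulr_ge0 ?enorm_ge0//.
by rewrite real_normK ?num_real// exprMn !enorm_sqr sum_mul_sqr_le.
Qed.

(* Young's inequality, with the parameter for which the factor of the second
   term becomes q = sqrt (1 - alpha) = 1 - theta and that of the first beta. *)
Lemma enormB_young (R : realType) (d : nat) (q : R) (u v : 'rV[R]_d) :
  0 <= q < 1 ->
  q ^+ 2 * enorm (u - v) ^+ 2
    <= q ^+ 2 / (1 - q) * enorm u ^+ 2 + q * enorm v ^+ 2.
Proof.
move=> /andP[q0 q1]; rewrite !enorm_sqr !mulr_sumr -big_split /=.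
apply: ler_sum => j _; rewrite !mxE.
set a := u ord0 j; set b := v ord0 j.
have q10 : 1 - q != 0 by rewrite subr_eq0 gt_eqF.
rewrite -subr_ge0.
(* Completing the square without dividing by [q] also covers [q = 0], that is alpha = 1. *)
rewrite (_ : _ - _ = q / (1 - q) * (q * a + (1 - q) * b) ^+ 2); last by field.
by rewrite mulr_ge0 ?sqr_ge0// divr_ge0// subr_ge0 ltW.
Qed.

(** * Directional derivatives and the descent inequality *)

Lemma dot_grad (R : realType) (d : nat) (h : 'rV[R]_d -> R) (x u : 'rV[R]_d) :
  differentiable h x -> 'D_u h x = dot (grad h x) u.
Proof.
move=> dh; rewrite deriveE// [in LHS](row_sum_delta u) linear_sum /=.
apply: eq_bigr => j _; rewrite linearZ /= mxE deriveE//.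
by rewrite mulrC.
Qed.

Lemma is_derive_line (R : realType) (d : nat) (h : 'rV[R]_d -> R)
    (x u : 'rV[R]_d) (s : R) :
  differentiable h (x + s *: u) ->
  is_derive s 1 (fun s : R => h (x + s *: u)) ('D_u h (x + s *: u)).
Proof.
move=> dh; have := @diff_derivable _ _ _ _ _ u dh.
(* Both difference quotients are the same function of [t], so derivability and its value
   transfer. *)
have E : (fun t : R => t^-1 *: (h (t *: u + (x + s *: u)) - h (x + s *: u)))
  = (fun t : R => t^-1 *: (h (x + (t *: (1 : R) + s) *: u) - h (x + s *: u))).
  apply/funext => t; congr (_ *: (h _ - _)).
  by rewrite scalerDl [t *: 1]mulr1 addrCA.
rewrite /derivable E => dl; split => //.
by rewrite /derive E.
Qed.

(** The mean value theorem replaces integration: [phi], which is [h] on the segment minus the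
    quadratic model, has nonpositive derivative on (0,1), so [phi 1 <= phi 0]. *)
Lemma descent_lemma (R : realType) (d : nat) (h : 'rV[R]_d -> R) (L : R) :
  (forall x, differentiable h x) ->
  (forall x y, enorm (grad h x - grad h y) <= L * enorm (x - y)) ->
  forall x u, h (x + u) <= h x + dot (grad h x) u + L / 2 * enorm u ^+ 2.
Proof.
move=> dh lip x u.
pose N := enorm u ^+ 2; pose a := dot (grad h x) u.
pose phi (s : R) : R := h (x + s *: u) - (a * s + L / 2 * N * s ^+ 2).
pose dphi (s : R) : R := dot (grad h (x + s *: u)) u - (a + L * N * s).
have phiD (s : R) : is_derive s 1 phi (dphi s).
  rewrite /phi /dphi -dot_grad//.
  apply: is_deriveB; first exact: is_derive_line.
  have E : (fun s : R => a * s + L / 2 * N * s ^+ 2)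
    = (a *: id + (L / 2 * N) *: (id ^+ 2)) :> (R -> R) by apply/funext.
  rewrite E; apply: is_derive_eq.
  rewrite /GRing.scale /=; lra.
have [|s] := MVT (@ltr01 R) (fun s _ => phiD s).
  by apply: derivable_within_continuous => s _; have [] := phiD s.
rewrite in_itv /= => /andP[s0 s1].
have : dphi s <= 0.
  rewrite /dphi opprD addrA subr_le0 -/a -dotBl.
  apply: le_trans (dot_le_enorm _ _) _.
  apply: le_trans (ler_wpM2r (enorm_ge0 _) (lip _ _)) _.
  by rewrite addrAC subrr add0r enormZ gtr0_norm// /N; lra.
rewrite /phi scale1r scale0r addr0 -/a -/N; nra.
Qed.

(** * Contraction of Top-K on sparse vectors *)

(* Either v vanishes off S, or S is contained in the support of v, and then each
   of the K kept squares dominates each of the at most #|J| - K dropped ones. *)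
Lemma topK_contract (R : realType) (d K : nat) (J : {set 'I_d})
    (v w : 'rV[R]_d) :
  is_topK K v w -> (forall j, j \notin J -> v ord0 j = 0) ->
  #|J|%:R * enorm (v - w) ^+ 2
    <= (#|J|%:R - (minn K #|J|)%:R) * enorm v ^+ 2.
Proof.
move=> [S [cS top ->]] vJ.
pose B : {set 'I_d} := [set k | (k \notin S) && (v ord0 k != 0)]%SET.
have -> : enorm (v - \row_j (if j \in S then v ord0 j else 0)) ^+ 2
    = \sum_(k in B) v ord0 k ^+ 2.
  rewrite enorm_sqr [RHS]big_mkcond /=; apply: eq_bigr => k _.
  rewrite !mxE inE; case: ifP => _ /=; first by rewrite subrr expr0n.
  by rewrite subr0; case: eqP => //= ->; rewrite expr0n.
have [B0|[k0 kB]] := set_0Vmem B.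
  rewrite B0 big_set0 mulr0 mulr_ge0 ?sqr_ge0// subr_ge0 ler_nat.
  exact: geq_minr.
(* A kept index outside [J] would carry the value 0, yet dominate the nonzero dropped entry at
   [k0]. *)
have SJ : S \subset J.
  apply/fintype.subsetP => j jS; apply: contraT => /vJ vj0.
  move: kB; rewrite inE => /andP[kS /negP[]].
  by move: (top _ _ jS kS); rewrite vj0 normr0 normr_le0.
have BJ : B \subset J.
  by apply/fintype.subsetP => k; rewrite inE => /andP[_]; apply: contraR => /vJ ->.
have dSB : [disjoint S & B].
  by rewrite finset.disjoints_subset; apply/fintype.subsetP => j jS; rewrite !inE jS.
have cSB : (K + #|B| <= #|J|)%N.
  have /eqP cU : #|S :|: B| == (#|S| + #|B|)%N by rewrite leq_card_setU.
  by rewrite -cS -cU subset_leq_card// finset.subUset SJ.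
rewrite (minn_idPl _); last by rewrite (leq_trans _ cSB)// leq_addr.
set b := \sum_(k in B) _; pose s := \sum_(j in S) v ord0 j ^+ 2.
have b0 : 0 <= b by apply: sumr_ge0 => k _; exact: sqr_ge0.
have s0 : 0 <= s by apply: sumr_ge0 => k _; exact: sqr_ge0.
have sb : s + b <= enorm v ^+ 2.
  rewrite enorm_sqr [leRHS](bigID [predU S & B]) /= bigU//= lerDl.
  by rewrite sumr_ge0// => j _; exact: sqr_ge0.
have Ksb : K%:R * b <= #|B|%:R * s.
  rewrite -cS !mulr_natl -sumr_const /s -sumrMnl.
  apply: ler_sum => j jS; rewrite -sumr_const; apply: ler_sum => k.
  rewrite inE => /andP[kS _].
  by rewrite -(real_normK (num_real (v ord0 k)))
    -(real_normK (num_real (v ord0 j))) lerXn2r ?nnegrE//; exact: top.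
have BK : #|B|%:R <= #|J|%:R - K%:R :> R.
  by rewrite lerBrDl -natrD ler_nat.
(* Split |J| b = K b + (|J| - K) b: the first term is at most (|J| - K) s, and s + b is at most the
   squared norm of [v]. *)
have h1 := ler_wpM2r s0 BK.
have h2 := ler_wpM2l (le_trans (ler0n _ _) BK) sb.
lra.
Qed.

(** * Averages over the n functions *)

Lemma favgE (R : realType) (n d : nat) (f : 'I_n -> 'rV[R]_d -> R) :
  favg f = n%:R^-1 *: (\sum_(i < n) f i).
Proof. by apply/funext => y; rewrite /favg /= fctE fct_sumE. Qed.

Lemma grad_favg (R : realType) (n d : nat) (f : 'I_n -> 'rV[R]_d -> R) x :
  (forall i x, differentiable (f i) x) ->
  grad (favg f) x = gmean (fun i => grad (f i) x).
Proof.
move=> df; apply/rowP => j; rewrite /gmean !mxE summxE favgE.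
rewrite deriveZ; last by apply: derivable_sum => i; exact: diff_derivable.
rewrite derive_sum; last by move=> i; exact: diff_derivable.
by congr (_ * _); apply: eq_bigr => i _; rewrite mxE.
Qed.

Lemma differentiable_favg (R : realType) (n d : nat)
    (f : 'I_n -> 'rV[R]_d -> R) x :
  (forall i x, differentiable (f i) x) -> differentiable (favg f) x.
Proof.
by move=> df; rewrite favgE; apply: differentiableZ; apply: differentiable_sum.
Qed.

(* Coordinate j of the mean has only #|Icol f j| nonzero contributions; this is
   the source of the gain c / n over the plain convexity bound. *)
Lemma gmean_err (R : realType) (n d : nat) (f : 'I_n -> 'rV[R]_d -> R)
    (g h : 'I_n -> 'rV[R]_d) :
  (forall i, in_Rdi f i (g i)) -> (forall i, in_Rdi f i (h i)) ->
  enorm (gmean g - gmean h) ^+ 2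
    <= (cmax f)%:R / n%:R * (n%:R^-1 * \sum_(i < n) enorm (g i - h i) ^+ 2).
Proof.
move=> gZ hZ.
have -> : \sum_(i < n) enorm (g i - h i) ^+ 2
    = \sum_(j < d) \sum_(i < n) (g i ord0 j - h i ord0 j) ^+ 2.
  rewrite exchange_big; apply: eq_bigr => i _; rewrite enorm_sqr.
  by apply: eq_bigr => j _; rewrite !mxE.
rewrite enorm_sqr mulrA mulr_sumr; apply: ler_sum => j _.
(* The factor [1] prepares Cauchy-Schwarz over [Icol f j], which then costs only the size of that
   set. *)
have -> : (gmean g - gmean h) ord0 j
    = n%:R^-1 * \sum_(i in Icol f j) 1 * (g i ord0 j - h i ord0 j).
  rewrite /gmean !mxE !summxE -mulrBr -sumrB; congr (_ * _).
  rewrite [RHS]big_mkcond /=; apply: eq_bigr => i _.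
  by rewrite inE mul1r; case: ifPn => // /negPn Zij; rewrite gZ// hZ// subrr.
rewrite exprMn.
set A := \sum_(i in _) _; set C := \sum_(i < n) _.
pose B := \sum_(i in Icol f j) (g i ord0 j - h i ord0 j) ^+ 2.
have AB : A ^+ 2 <= #|Icol f j|%:R * B.
  apply: le_trans (sum_mul_sqr_le _ _ _) _.
  by under eq_bigr do rewrite expr1n; rewrite sumr_const.
have B0 : 0 <= B by apply: sumr_ge0 => i _; exact: sqr_ge0.
have BC : B <= C.
  rewrite /C (bigID (mem (Icol f j))) /= lerDl.
  by apply: sumr_ge0 => i _; exact: sqr_ge0.
have cj : #|Icol f j|%:R <= (cmax f)%:R :> R by rewrite ler_nat /cmax leq_bigmax.
have AC : A ^+ 2 <= (cmax f)%:R * C.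
  by apply: le_trans AB _; rewrite ler_pM// ler0n.
rewrite (_ : _ / _ * _ * C = n%:R^-1 ^+ 2 * ((cmax f)%:R * C)); last by ring.
by rewrite ler_wpM2l// sqr_ge0.
Qed.

(** * Telescoping and positivity of alpha *)

(** Here [N] and [D] stand for the squared norms of grad f(x^t) and g^t. The weight [r / e] makes
    the decay of [G] absorb [r * G t], and [r * b <= e * c] lets the descent absorb the [D]
    terms. *)
Lemma telescope_lyapunov (R : realFieldType) (F N D G : nat -> R)
    (a b c e r : R) :
  0 < e -> 0 <= r -> r * b <= e * c ->
  (forall t, 0 <= D t) ->
  (forall t, F t.+1 <= F t - a * N t - c * D t + r * G t) ->
  (forall t, G t.+1 <= (1 - e) * G t + b * D t) ->
  forall T, a * (\sum_(0 <= t < T) N t) + F T + r / e * G T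
    <= F 0 + r / e * G 0.
Proof.
move=> e0 r0 rb D0 hF hG; elim=> [|T IH].
  by rewrite big_geq// mulr0 add0r.
rewrite big_nat_recr//= mulrDr.
have re0 : 0 <= r / e by rewrite divr_ge0// ltW.
have h1 := ler_wpM2l re0 (hG T).
have h2 : r / e * b <= c by rewrite mulrAC ler_pdivrMr// (mulrC c).
have h3 := ler_wpM2r (D0 T) h2.
have h4 : r / e * e = r by rewrite mulfVK// gt_eqF.
have h5 : r / e * (e * G T) = r * G T by rewrite mulrA h4.
have := hF T; lra.
Qed.

Lemma alpha_i_gt0 (R : realType) (n d : nat) (f : 'I_n -> 'rV[R]_d -> R)
    (K : 'I_n -> nat) (i : 'I_n) :
  (0 < K i)%N -> (0 < #|Jrow f i|)%N -> 0 < alpha_i f K i.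
Proof. by move=> K0 J0; rewrite divr_gt0 ?ltr0n// leq_min K0. Qed.

(** This gives sqrt (1 - alpha) < 1, so theta is positive and the denominator of beta is nonzero. *)
Lemma alpha_min_gt0 (R : realType) (n d : nat) (f : 'I_n -> 'rV[R]_d -> R)
    (K : 'I_n -> nat) :
  (forall i, 0 < K i)%N -> (forall i, 0 < #|Jrow f i|)%N -> 0 < alpha_min f K.
Proof. by move=> K0 J0; apply: lt_bigmin => // i _; exact: alpha_i_gt0. Qed.

(** * One iteration of EF21 *)

Section ef21_step.
Variables (R : realType) (n d : nat) (f : 'I_n -> 'rV[R]_d -> R).
Variables (Top : nat -> 'rV[R]_d -> 'rV[R]_d) (K : 'I_n -> nat) (gamma : R).
Variables (x0 : 'rV[R]_d) (g0 : 'I_n -> 'rV[R]_d).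
Hypothesis hJ : forall i : 'I_n, (1 <= #|Jrow f i|)%N.
Hypothesis hTop : is_Top Top.
Hypothesis hK : forall i : 'I_n, (1 <= K i <= d)%N.
Hypothesis hg0 : forall i : 'I_n, in_Rdi f i (g0 i).

Let xt := ef21_x f Top K gamma x0 g0.
Let gt := ef21_g f Top K gamma x0 g0.
Let G := Gerr f Top K gamma x0 g0.

Lemma ef21_xS t : xt t.+1 = xt t - gamma *: gmean (gt t).
Proof. by rewrite /xt /gt /ef21_x /ef21_g /=; case: ef21. Qed.

Lemma ef21_gS t i :
  gt t.+1 i = gt t i + Top (K i) (grad (f i) (xt t.+1) - gt t i).
Proof. by rewrite /xt /gt /ef21_x /ef21_g /=; case: ef21. Qed.

Lemma grad_in_Rdi i x : in_Rdi f i (grad (f i) x).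
Proof. by move=> j /asboolP. Qed.

(** Top-K only copies or zeroes entries, so the sparsity pattern persists; both the contraction and
    [gmean_err] rely on it. *)
Lemma ef21_g_in_Rdi t i : in_Rdi f i (gt t i).
Proof.
elim: t => [|t IH]; first exact: hg0.
move=> j Zij; rewrite ef21_gS mxE IH// add0r.
have [S [_ _ ->]] := hTop (grad (f i) (xt t.+1) - gt t i) (hK i).
by rewrite !mxE IH//; case: ifP => // _; have := grad_in_Rdi (xt t.+1) Zij;
  rewrite mxE => ->; rewrite subr0.
Qed.

Lemma Top_contract i v : in_Rdi f i v ->
  enorm (v - Top (K i) v) ^+ 2 <= (1 - alpha_min f K) * enorm v ^+ 2.
Proof.
move=> vZ; have vJ j : j \notin Jrow f i -> v ord0 j = 0.
  by rewrite inE negbK; exact: vZ.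
have := topK_contract (hTop v (hK i)) vJ.
have J0 : 0 < #|Jrow f i|%:R :> R by rewrite ltr0n.
rewrite mulrC -ler_pdivlMr// mulrAC mulrBl divff ?gt_eqF// -/(alpha_i f K i).
move=> /le_trans; apply; rewrite ler_wpM2r ?sqr_ge0// lerD2l lerN2.
exact: bigmin_le.
Qed.

Lemma Gerr_step (Lp : R) t :
  (forall x y : 'rV[R]_d,
    n%:R^-1 * (\sum_(i < n) enorm (grad (f i) x - grad (f i) y) ^+ 2)
      <= Lp ^+ 2 * enorm (x - y) ^+ 2) ->
  G t.+1 <= (1 - theta (alpha_min f K)) * G t
    + beta (alpha_min f K)
      * (Lp ^+ 2 * (gamma ^+ 2 * enorm (gmean (gt t)) ^+ 2)).
Proof.
move=> lip; set al := alpha_min f K.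
pose q : R := Num.sqrt (1 - al).
have al0 : 0 < al by apply: alpha_min_gt0 => // i; case/andP: (hK i).
have al1 : al <= 1 by exact: bigmin_le_id.
have q2 : q ^+ 2 = 1 - al by rewrite sqr_sqrtr// subr_ge0.
have q01 : 0 <= q < 1.
  by rewrite sqrtr_ge0 -[ltRHS]sqrtr1 ltr_sqrt//=; lra.
have xx : enorm (xt t.+1 - xt t) ^+ 2 = gamma ^+ 2 * enorm (gmean (gt t)) ^+ 2.
  by rewrite ef21_xS addrAC subrr add0r enormN enormZ_sqr.
have b0 : 0 <= beta al.
  rewrite /beta -/q -q2 divr_ge0 ?sqr_ge0// subr_ge0.
  by case/andP: q01 => _ /ltW.
rewrite -xx; apply: le_trans (lerD (lexx _) (ler_wpM2l b0 (lip _ _))).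
rewrite /G /Gerr -/xt -/gt /theta -/q opprB addrCA subrr addr0.
rewrite mulrCA [beta _ * _]mulrCA -mulrDr ler_wpM2l ?invr_ge0 ?ler0n//.
rewrite !mulr_sumr -big_split /=; apply: ler_sum => i _.
set v := grad (f i) (xt t.+1) - gt t i.
have vZ : in_Rdi f i v.
  move=> j Zij; rewrite /v mxE (grad_in_Rdi _ Zij) add0r mxE.
  by rewrite ef21_g_in_Rdi// oppr0.
have -> : gt t.+1 i - grad (f i) (xt t.+1) = - (v - Top (K i) v).
  by rewrite ef21_gS -/v; set w := Top _ _; rewrite /v !opprB addrA (addrC w).
rewrite enormN; apply: le_trans (Top_contract vZ) _; rewrite -/al -q2.
rewrite addrC /beta -/q -q2.
(* Change of gradient minus old error: Young gives the former the factor beta and the latter [q],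
   which is 1 - theta. *)
have -> : v = (grad (f i) (xt t.+1) - grad (f i) (xt t))
   - (gt t i - grad (f i) (xt t)).
  by rewrite /v opprB addrA subrK.
exact: enormB_young.
Qed.

(** Polarization writes -gamma <grad f, g> as gamma/2 (|g - grad f|^2 - |g|^2 - |grad f|^2), and
    [gmean_err] turns the first square into the [G] term. *)
Lemma favg_step (L : R) t :
  0 < gamma ->
  (forall i x, differentiable (f i) x) ->
  (forall x y : 'rV[R]_d,
    enorm (grad (favg f) x - grad (favg f) y) <= L * enorm (x - y)) ->
  favg f (xt t.+1) <= favg f (xt t)
    - gamma / 2 * enorm (grad (favg f) (xt t)) ^+ 2
    - gamma / 2 * (1 - L * gamma) * enorm (gmean (gt t)) ^+ 2
    + gamma / 2 * ((cmax f)%:R / n%:R) * G t.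
Proof.
move=> gamma0 df lip.
have := descent_lemma (fun x => differentiable_favg x df) lip (xt t)
  (- gamma *: gmean (gt t)).
rewrite {1}scaleNr -ef21_xS dotZr enormZ_sqr.
have := gmean_err (ef21_g_in_Rdi t) (fun i => @grad_in_Rdi i (xt t)).
rewrite -grad_favg// enormB_sqr.
have -> : dot (gmean (gt t)) (grad (favg f) (xt t))
    = dot (grad (favg f) (xt t)) (gmean (gt t)).
  by apply: eq_bigr => j _; exact: mulrC.
rewrite -/(Gerr f Top K gamma x0 g0 t) -/G => err dec.
have := ler_wpM2l (ltW gamma0) err.
lra.
Qed.

End ef21_step.

(** * Stepsize condition and conclusion *)

Theorem theorem2 (R : realType) (n d : nat) (hn : (0 < n)%N) (hd : (0 < d)%N)
  (f : 'I_n -> 'rV[R]_d -> R)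
  (hdiff : forall (i : 'I_n) (x : 'rV[R]_d), differentiable (f i) x)
  (hI : forall j : 'I_d, (1 <= #|Icol f j|)%N)
  (hJ : forall i : 'I_n, (1 <= #|Jrow f i|)%N)
  (L : R) (hL : 0 < L)
  (hLip : forall x y : 'rV[R]_d,
    enorm (grad (favg f) x - grad (favg f) y) <= L * enorm (x - y))
  (fstar : R) (hfstar : forall x : 'rV[R]_d, fstar <= favg f x)
  (Lp : R) (hLp : 0 <= Lp)
  (hLipp : forall x y : 'rV[R]_d,
    n%:R^-1 * (\sum_(i < n) enorm (grad (f i) x - grad (f i) y) ^+ 2)
      <= Lp ^+ 2 * enorm (x - y) ^+ 2)
  (Top : nat -> 'rV[R]_d -> 'rV[R]_d) (hTop : is_Top Top)
  (K : 'I_n -> nat) (hK : forall i : 'I_n, (1 <= K i <= d)%N)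
  (gamma : R) (hgamma0 : 0 < gamma)
  (hgamma : let alpha := alpha_min f K in
    gamma <= 1 / (L + Lp * Num.sqrt (beta alpha * (cmax f)%:R
                                     / (theta alpha * n%:R))))
  (x0 : 'rV[R]_d) (g0 : 'I_n -> 'rV[R]_d)
  (hg0 : forall i : 'I_n, in_Rdi f i (g0 i))
  (T : nat) (hT : (1 <= T)%N) :
  T%:R^-1 * (\sum_(0 <= t < T)
      enorm (grad (favg f) (ef21_x f Top K gamma x0 g0 t)) ^+ 2)
    <= 2 * (favg f x0 - fstar) / (gamma * T%:R)
       + (cmax f)%:R / n%:R
         * (Gerr f Top K gamma x0 g0 0 / (theta (alpha_min f K) * T%:R)).
Proof.
move: hgamma => /=; set al := alpha_min f K => hgam.
pose q : R := Num.sqrt (1 - al).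
have al0 : 0 < al by apply: alpha_min_gt0 => // i; case/andP: (hK i).
have al1 : al <= 1 by exact: bigmin_le_id.
have q1 : q < 1.
  by rewrite -[ltRHS]sqrtr1 ltr_sqrt//; lra.
have th0 : 0 < theta al by rewrite /theta -/q subr_gt0.
have th0' := ltW th0; have gam0 := ltW hgamma0.
have be0 : 0 <= beta al by rewrite /beta -/q divr_ge0 ?subr_ge0// ltW.
have n0 : 0 < n%:R :> R by rewrite ltr0n.
pose cn : R := (cmax f)%:R / n%:R.
have cn0 : 0 <= cn by rewrite divr_ge0.
pose M : R := beta al * (cmax f)%:R / (theta al * n%:R).
have ME : M * theta al = cn * beta al.
  by rewrite /M /cn; field; rewrite !gt_eqF.
have M0 : 0 <= M by apply: divr_ge0; apply: mulr_ge0.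
(* The stepsize bound says a <= 1 - L gamma < 1 with a >= 0, hence a^2 <= a <= 1 - L gamma. *)
have key : (gamma * Lp) ^+ 2 * M <= 1 - L * gamma.
  pose a := gamma * Lp * Num.sqrt M.
  have a0 : 0 <= a by rewrite !mulr_ge0 ?sqrtr_ge0.
  have -> : (gamma * Lp) ^+ 2 * M = a ^+ 2 by rewrite /a [RHS]exprMn sqr_sqrtr.
  have D0 : 0 < L + Lp * Num.sqrt M by rewrite ltr_pwDl// mulr_ge0 ?sqrtr_ge0.
  move: hgam; rewrite -/M ler_pdivlMr// => hgam.
  have aL : a <= 1 - L * gamma by rewrite /a; lra.
  have : 0 < L * gamma by rewrite mulr_gt0.
  nra.
(* The compatibility condition [r * b <= e * c] of the telescoping lemma: [key] multiplied by theta
   gamma / 2. *)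
have rb : gamma / 2 * cn * (beta al * (Lp ^+ 2 * gamma ^+ 2))
    <= theta al * (gamma / 2 * (1 - L * gamma)).
  have -> : gamma / 2 * cn * (beta al * (Lp ^+ 2 * gamma ^+ 2))
      = gamma / 2 * (gamma * Lp) ^+ 2 * (M * theta al) by rewrite ME; ring.
  have -> : gamma / 2 * (gamma * Lp) ^+ 2 * (M * theta al)
      = theta al * (gamma / 2) * ((gamma * Lp) ^+ 2 * M) by ring.
  by rewrite [leRHS]mulrA ler_wpM2l// mulr_ge0 ?divr_ge0.
have hG t := Gerr_step gamma x0 hJ hTop hK hg0 t hLipp.
have hF t := favg_step x0 hTop hK hg0 t hgamma0 hdiff hLip.
set xt := ef21_x f Top K gamma x0 g0; set G := Gerr f Top K gamma x0 g0.
have hG' t : G t.+1 <= (1 - theta al) * G t + beta al * (Lp ^+ 2 * gamma ^+ 2)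
    * enorm (gmean (ef21_g f Top K gamma x0 g0 t)) ^+ 2.
  by have := hG t; rewrite -/al -/G; rewrite !mulrA.
have r0 : 0 <= gamma / 2 * cn by rewrite mulr_ge0 ?divr_ge0.
set S := \sum_(0 <= t < T) _.
have h1 : gamma / 2 * S + favg f (xt T) + gamma / 2 * cn / theta al * G T
    <= favg f x0 + gamma / 2 * cn / theta al * G 0.
  exact: (telescope_lyapunov th0 r0 rb (fun t => sqr_ge0 _) hF hG' T).
(* The final Lyapunov value is discarded: its [G T] part is nonnegative and [fstar] bounds f(x^T)
   from below. *)
have GT0 : 0 <= G T.
  by rewrite mulr_ge0 ?invr_ge0// sumr_ge0// => i _; exact: sqr_ge0.
have h2 := mulr_ge0 (divr_ge0 r0 (ltW th0)) GT0.
have h3 := hfstar (xt T).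
have T0 : 0 < T%:R :> R by rewrite ltr0n.
have h4 : gamma / 2 * S <= favg f x0 - fstar + gamma / 2 * cn / theta al * G 0.
  lra.
(* The factor 2 / (gamma T) turns the weight gamma c / (2 n theta) of G^0 into c / (n theta T). *)
rewrite (_ : _ + _ = T%:R^-1 * (2 / gamma *
   (favg f x0 - fstar + gamma / 2 * cn / theta al * G 0))); last first.
  by rewrite /cn; field; rewrite !gt_eqF.
rewrite ler_wpM2l ?invr_ge0// [2 / _ * _]mulrAC ler_pdivlMr//; lra.
Qed.
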